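(* Let $T=\langle X_n,Q,\pi,\lambda\rangle$ be a finite, minimal, one-way synchronizing, synchronous transducer and let $S=\langle X_n,Q^{-1},\pi',\lambda'\rangle$ be its inverse. Let $0<k\in\mathbb{N}$ be the minimal synchronizing length of $T$ (the least level at which $T$ is synchronizing). Then the automaton group $\mathcal{G}(TS)$ generated by $TS$ is isomorphic to the subgroup of the symmetric group $S_{n^k}$ generated by the permutations $\lambda_{TS}(\,\cdot\,,p):X_n^k\to X_n^k$, where $p$ ranges over the states of $TS$ and $\lambda_{TS}$ is the output function of $TS$. In particular, this group is finite.
   Context: $n\ge2$, $X_n=\{0,\dots,n-1\}$, $X_n^k$ is the set of words of length $k$ over $X_n$, $\mathfrak{C}_n=X_n^\omega$ is Cantor space. Functions act on the right. A synchronous transducer $T=\langle X_n,Q,\pi,\lambda\rangle$ consists of a finite state set $Q$ and functions $\pi:X_n\times Q\to Q$, $\lambda:X_n\times Q\to X_n$, extended to words by $\pi(xw,q)=\pi(w,\pi(x,q))$, $\lambda(xw,q)=\lambda(x,q)\lambda(w,\pi(x,q))$ (and $\lambda$ to infinite words). $T_q$ is the map $\mathfrak{C}_n\to\mathfrak{C}_n$, $\delta\mapsto\lambda(\delta,q)$. $T$ is minimal if distinct states induce distinct maps $T_q$. $T$ is invertible if each $\lambda(\cdot,q):X_n\to X_n$ is a permutation; its inverse is then $S=\langle X_n,Q^{-1},\pi',\lambda'\rangle$, where $q\mapsto q^{-1}$ is a bijection $Q\to Q^{-1}$ and, whenever $\pi(x,q)=p$ and $\lambda(x,q)=y$, one has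 $\pi'(y,q^{-1})=p^{-1}$ and $\lambda'(y,q^{-1})=x$. Thus $S_{q^{-1}}=T_q^{-1}$. The transducer $T$ is assumed invertible. The product $TS$ has states $Q\times Q^{-1}$, $\lambda_{TS}(i,(t,s))=\lambda'(\lambda(i,t),s)$, $\pi_{TS}(i,(t,s))=(\pi(i,t),\pi'(\lambda(i,t),s))$; $(TS)_{(t,s)}$ is $T_t$ followed by $S_s$. The automaton group $\mathcal{G}(TS)$ is the group of homeomorphisms of $\mathfrak{C}_n$ generated by the maps $(TS)_p$, $p$ a state of $TS$. $T$ is synchronizing at level $k$ if there is $f:X_n^k\to Q$ with $\pi(\alpha,q)=f(\alpha)$ for all $\alpha\in X_n^k$ and $q\in Q$; it is synchronizing if so at some level; it is one-way synchronizing if it is synchronizing but its inverse is not. $S_{n^k}$ is identified with the symmetric group on the set $X_n^k$. *)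

(* Defs.v *)
From HB Require Import structures.
From mathcomp Require Import all_boot all_order all_fingroup.
From mathcomp Require Import all_classical topology.

Set Implicit Arguments.
Unset Strict Implicit.
Unset Printing Implicit Defensive.

Local Open Scope classical_set_scope.
Local Open Scope group_scope.

(** Homeomorphisms of a space onto itself. Functions act on the right, so the
    product [f * g] is [f] followed by [g], as for [{perm T}]. *)

Record homeo (X : topologicalType) := Homeo {
  homeo_fun :> X -> X;
  homeo_inv : X -> X;
  homeoK : cancel homeo_fun homeo_inv;
  homeoVK : cancel homeo_inv homeo_fun;
  homeo_continuous : continuous homeo_fun;
  homeo_inv_continuous : continuous homeo_inv
}.

HB.instance Definition _ (X : topologicalType) := gen_eqMixin (homeo X).
HB.instance Definition _ (X : topologicalType) := gen_choiceMixin (homeo X).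

Lemma homeoP (X : topologicalType) (f g : homeo X) : f =1 g -> f = g.
Proof.
case: f g => f f' fK f'K cf cf' [g g' gK g'K cg cg'] /= /funext efg.
case: _ / efg gK g'K cg => gK g'K cg.
have /funext e : f' =1 g' by move=> x; rewrite -{1}[x]g'K fK.
case: _ / e gK g'K cg' => gK g'K cg'.
by congr Homeo; exact: Prop_irrelevance.
Qed.

Section HomeoGroup.
Variable X : topologicalType.
Implicit Types f g h : homeo X.

Definition homeo_one : homeo X :=
  @Homeo X id id (fun=> erefl) (fun=> erefl) (fun _ => cvg_id) (fun _ => cvg_id).

Definition homeo_opp f : homeo X :=
  @Homeo X (homeo_inv f) f (@homeoVK X f) (@homeoK X f)
    (@homeo_inv_continuous X f) (@homeo_continuous X f).

Lemma homeo_mulK f g : cancel (g \o f) (homeo_inv f \o homeo_inv g).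
Proof. by move=> x /=; rewrite !homeoK. Qed.

Lemma homeo_mul_continuous (u v : X -> X) :
  continuous u -> continuous v -> continuous (v \o u).
Proof. by move=> cu cv x; apply: continuous_comp; [exact: cu | exact: cv]. Qed.

Definition homeo_mul f g : homeo X :=
  @Homeo X (g \o f) (homeo_inv f \o homeo_inv g)
    (homeo_mulK f g) (homeo_mulK (homeo_opp g) (homeo_opp f))
    (homeo_mul_continuous (@homeo_continuous X f) (@homeo_continuous X g))
    (homeo_mul_continuous (@homeo_inv_continuous X g)
                          (@homeo_inv_continuous X f)).

Lemma homeo_mulA : associative homeo_mul.
Proof. by move=> f g h; exact: homeoP. Qed.
Lemma homeo_1mul : left_id homeo_one homeo_mul.
Proof. by move=> f; exact: homeoP. Qed.
Lemma homeo_mul1 : right_id homeo_one homeo_mul.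
Proof. by move=> f; exact: homeoP. Qed.
Lemma homeo_Vmul : left_inverse homeo_one homeo_opp homeo_mul.
Proof. by move=> f; apply: homeoP => x; exact: homeoVK. Qed.
Lemma homeo_mulV : right_inverse homeo_one homeo_opp homeo_mul.
Proof. by move=> f; apply: homeoP => x; exact: homeoK. Qed.

HB.instance Definition _ := isGroup.Build (homeo X)
  homeo_mulA homeo_1mul homeo_mul1 homeo_Vmul homeo_mulV.

End HomeoGroup.

Definition generated_subgroup (G : groupType) (A : set G) : set G :=
  smallest [set H : set G | group_closed (mem H)] A.

(** [A] and [B] are meant to be subgroups of [G] and [H]; only the values of
    [phi] on [A] matter. *)
Definition subgroups_isomorphic (G H : groupType) (A : set G) (B : set H) :=
  exists phi : G -> H,
    {in A &, {morph phi : x y / x * y}} /\ set_bij A B phi.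

(** Infinite words, with the product of the discrete topologies. *)
Definition infinite_word (n : nat) : Type :=
  {ptws nat -> discrete_topology 'I_n}.

HB.instance Definition _ n := Topological.on (infinite_word n).

Record transducer (n : nat) := Transducer {
  state : finType;
  trans : 'I_n -> state -> state;
  out : 'I_n -> state -> 'I_n
}.

Section Transducer.
Variables (n : nat) (T : transducer n).
Implicit Types (w : seq 'I_n) (q : state T).

Fixpoint trans_word w q : state T :=
  if w is x :: w' then trans_word w' (trans x q) else q.

Fixpoint out_word w q : seq 'I_n :=
  if w is x :: w' then out x q :: out_word w' (trans x q) else [::].

Lemma size_out_word w q : size (out_word w q) == size w.
Proof. by elim: w q => //= x w IH q; exact: IH. Qed.

Lemma out_tuple_subproof k (w : k.-tuple 'I_n) q : size (out_word w q) == k.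
Proof. by rewrite (eqP (size_out_word w q)) size_tuple. Qed.

Definition out_tuple k q (w : k.-tuple 'I_n) : k.-tuple 'I_n :=
  Tuple (out_tuple_subproof w q).

(** The map T_q: the [i]-th output letter is read off in the state reached
    after the first [i] letters of the input. *)
Definition out_infinite q (d : infinite_word n) : infinite_word n :=
  fun i => out (d i) (trans_word (@mkseq 'I_n d i) q).

Definition minimal := injective out_infinite.

(** The level [0] is allowed: it then says that [T] has exactly one state. *)
Definition synchronizing_at (k : nat) :=
  exists f : k.-tuple 'I_n -> state T,
    forall (a : k.-tuple 'I_n) (q : state T), trans_word a q = f a.

Definition synchronizing := exists k, synchronizing_at k.

Definition minimal_synchronizing_length (k : nat) :=
  synchronizing_at k /\ forall j, synchronizing_at j -> k <= j.

Definition invertible := forall q, bijective (fun x : 'I_n => out x q).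

End Transducer.

Record invertible_transducer (n : nat) := InvertibleTransducer {
  transducer_of :> transducer n;
  out_bij : invertible transducer_of
}.

Section Inverse.
Variables (n : nat) (T : invertible_transducer n).

Definition out_inv (y : 'I_n) (q : state T) : 'I_n :=
  invF (bij_inj (@out_bij n T q)) y.

Lemma out_invK (q : state T) : cancel (@out n T ^~ q) (out_inv ^~ q).
Proof. by move=> x; exact: invF_f. Qed.

Lemma out_invVK (q : state T) : cancel (out_inv ^~ q) (@out n T ^~ q).
Proof. by move=> y; rewrite /out_inv (f_invF (bij_inj (@out_bij n T q))). Qed.

(** The set of states of the inverse is a copy of that of [T]: the state
    q^{-1} is [q] itself. *)
Definition inverse_transducer : transducer n :=
  @Transducer n (state T) (fun y q => trans (out_inv y q) q) out_inv.

Lemma inverse_invertible : invertible inverse_transducer.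
Proof.
by move=> q; exists (@out n T ^~ q); [exact: out_invVK | exact: out_invK].
Qed.

Definition inverse : invertible_transducer n :=
  InvertibleTransducer inverse_invertible.

Lemma inverseE (x y : 'I_n) (q p : state T) :
  trans x q = p -> out x q = y ->
  @trans n inverse y q = p /\ @out n inverse y q = x.
Proof. by move=> <- <- /=; rewrite out_invK. Qed.

Lemma trans_word_inverse w (q : state T) :
  @trans_word n inverse (out_word w q) q = trans_word w q.
Proof. by elim: w q => //= x w IH q; rewrite out_invK; exact: IH. Qed.

Lemma out_word_inverse w (q : state T) :
  @out_word n inverse (out_word w q) q = w.
Proof. by elim: w q => //= x w IH q; rewrite out_invK; congr cons; exact: IH. Qed.

End Inverse.

Definition one_way_synchronizing n (T : invertible_transducer n) :=
  synchronizing T /\ ~ synchronizing (inverse T).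

Section Product.
Variables (n : nat) (T S : invertible_transducer n).

Definition product_transducer : transducer n :=
  @Transducer n (state T * state S)%type
    (fun i ts => (trans i ts.1, trans (out i ts.1) ts.2))
    (fun i ts => out (out i ts.1) ts.2).

Lemma product_invertible : invertible product_transducer.
Proof. by move=> [t s]; exact: (bij_comp (out_bij s) (out_bij t)). Qed.

Definition product : invertible_transducer n :=
  InvertibleTransducer product_invertible.

End Product.

Section StateMaps.
Variables (n : nat) (T : transducer n).

Lemma trans_word_rcons (w : seq 'I_n) x (q : state T) :
  trans_word (rcons w x) q = trans x (trans_word w q).
Proof. by elim: w q => //= y w IH q; exact: IH. Qed.

Lemma out_word_rcons (w : seq 'I_n) x (q : state T) :
  out_word (rcons w x) q = rcons (out_word w q) (out x (trans_word w q)).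
Proof. by elim: w q => //= y w IH q; congr cons; exact: IH. Qed.

Lemma mkseq_out_infinite (q : state T) (d : infinite_word n) i :
  @mkseq 'I_n (out_infinite q d) i = out_word (@mkseq 'I_n d i) q.
Proof.
elim: i => // i IH.
by rewrite !mkseqS out_word_rcons -IH.
Qed.

Lemma infinite_word_letter_continuous i :
  continuous (fun d : infinite_word n => d i : discrete_topology 'I_n).
Proof. exact: (@proj_continuous nat (fun=> discrete_topology 'I_n) i). Qed.

Lemma nbhs_prefix (d : infinite_word n) i :
  nbhs d [set e : infinite_word n | @mkseq 'I_n e i = @mkseq 'I_n d i].
Proof.
elim: i => [|i IH].
  by apply: filterS (@filterT _ (nbhs d) _).
have di : nbhs d [set e : infinite_word n | e i = d i].
  apply: (@infinite_word_letter_continuous i d [set d i]).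
  exact: (@discrete_set1 (discrete_topology 'I_n)).
apply: filterS2 IH di => e /= IH di.
by rewrite !mkseqS IH di.
Qed.

Lemma out_infinite_continuous (q : state T) : continuous (out_infinite q).
Proof.
move=> d; have FF : Filter (out_infinite q @ d).
  by apply: fmap_filter; exact: nbhs_filter.
apply/cvg_sup => i; apply/cvg_image.
  by rewrite eqEsubset; split => // y _; exists (fun=> y).
move=> U /= /principal_filterP Ui.
exists [set e : infinite_word n | U (e i)].
  apply: filterS (nbhs_prefix d i.+1) => e /=.
  rewrite !mkseqS => /rcons_inj[ew ex].
  by rewrite /out_infinite ew ex.
by rewrite eqEsubset; split => [y [e ? <-]//|y Uy]; exists (fun=> y).
Qed.

End StateMaps.

Section AutomatonGroup.
Variables (n : nat) (T : invertible_transducer n).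

Lemma out_infiniteK (q : state T) :
  cancel (out_infinite q) (@out_infinite n (inverse T) q).
Proof.
move=> d; apply/funext => i.
by rewrite {1}/out_infinite mkseq_out_infinite trans_word_inverse /= out_invK.
Qed.

Lemma out_infiniteVK (q : state T) :
  cancel (@out_infinite n (inverse T) q) (out_infinite q).
Proof.
move=> d; apply/funext => i; rewrite {1}/out_infinite mkseq_out_infinite.
suff -> : trans_word (@out_word n (inverse T) (@mkseq 'I_n d i) q) q =
          @trans_word n (inverse T) (@mkseq 'I_n d i) q by exact: out_invVK.
by elim: (@mkseq 'I_n d i) q => //= x w IH q; rewrite out_invVK; exact: IH.
Qed.

Lemma out_tuple_inj k (q : state T) : injective (@out_tuple n T k q).
Proof.
move=> v w /(congr1 val) /= evw; apply: val_inj.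
by rewrite /= -[LHS](out_word_inverse _ q) evw out_word_inverse.
Qed.

Definition state_homeo (q : state T) : homeo (infinite_word n) :=
  @Homeo _ (out_infinite q) (@out_infinite n (inverse T) q)
    (out_infiniteK q) (out_infiniteVK q)
    (@out_infinite_continuous n T q)
    (@out_infinite_continuous n (inverse T) q).

Definition automaton_group : set (homeo (infinite_word n)) :=
  generated_subgroup (range state_homeo).

Definition level_perm k (q : state T) : {perm k.-tuple 'I_n} :=
  perm (@out_tuple_inj k q).

Definition level_group k : {set {perm k.-tuple 'I_n}} :=
  <<[set level_perm k q | q : state T]>>%g.

End AutomatonGroup.

Lemma state_homeo_inverse n (T : invertible_transducer n) (q : state T) :
  @state_homeo n (inverse T) q = (state_homeo q)^-1.
Proof. exact: homeoP. Qed.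

Lemma state_homeo_product n (T S : invertible_transducer n)
    (t : state T) (s : state S) :
  @state_homeo n (product T S) (t, s) = state_homeo t * state_homeo s.
Proof.
apply: homeoP => d; apply/funext => i /=.
rewrite /out_infinite -/(out_infinite t d) mkseq_out_infinite.
suff -> : @trans_word n (product T S) (@mkseq 'I_n d i) (t, s) =
          (trans_word (@mkseq 'I_n d i) t, trans_word (out_word (@mkseq 'I_n d i) t) s).
  by [].
by elim: (@mkseq 'I_n d i) t s => //= x w IH t s; exact: IH.
Qed.

(* Main.v *)
Require Import Defs.
From mathcomp Require Import all_boot all_order all_fingroup.
From mathcomp Require Import all_classical topology.

(** Fix a level [k]. Splitting an infinite word into its prefix of length [k]
    and the remaining tail, a permutation [u] of the words of length [k] and a
    homeomorphism [g w] for each such word [w] define the homeomorphism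
    [wreath u g], [w d |-> (u w) (g w d)]; these multiply as in a permutational
    wreath product ([wreath_mul]). Every state of an invertible transducer acts
    in this way ([state_homeo_wreath]): [u] is its action on words of length [k]
    and [g w] is the action of the state reached after reading [w].

    If [T] is synchronizing at level [k], through [f], then reading [w] from a
    state [(t, s)] of [T T^-1] leads to [(f w, f (u w))], where [u w] is the
    output ([trans_word_sync]): the inverse automaton, while it reads a word
    and writes [u w], runs through the states that [T] visits on input [u w].
    Hence the state [(t, s)] acts as [w d |-> (u w) (T_(f w) T_(f (u w))^-1 d)],
    which depends on [u] only. The map sending any permutation [u] to the latter
    homeomorphism ([sync_lift]) is a morphism, because the factors [T_(f w)]
    telescope, and it is injective, because [u] can be read off the prefixes. It
    maps the generators of the level group onto those of the automaton group,
    and therefore maps the first group isomorphically onto the second. *)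

Set Implicit Arguments.
Unset Strict Implicit.
Unset Printing Implicit Defensive.

Local Open Scope classical_set_scope.
Local Open Scope group_scope.

(** * Subgroups generated by the image of a morphism *)

Section GeneratedImage.
Variables (gT : finGroupType) (G : groupType) (psi : gT -> G).
Hypothesis psiM : {morph psi : x y / x * y}.

Let psi1 : psi 1 = 1.
Proof. by apply: (mulgI (psi 1)); rewrite -psiM !mulg1. Qed.

Let psiV x : psi x^-1 = (psi x)^-1.
Proof. by apply: (mulgI (psi x)); rewrite -psiM !mulgV psi1. Qed.

Lemma generated_subgroup_image (A : {set gT}) :
  generated_subgroup (psi @` [set` A]) = psi @` [set` <<A>>%g].
Proof.
apply/seteqP; split.
  apply: smallest_sub => [|_ [x xA <-]]; last first.
    by exists x => //; exact: mem_gen.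
  split=> [|_ _ /set_mem[x xA <-] /set_mem[y yA <-]]; apply/mem_set.
    by exists 1; [exact: group1 | exact: psi1].
  exists (x * y^-1); first by apply: groupM; rewrite ?groupV.
  by rewrite psiM psiV.
move=> _ [x xA <-] H [[/set_mem H1 HD] AH].
have Hdiv y z : H y -> H z -> H (y * z^-1).
  by move=> Hy Hz; exact: set_mem (HD _ _ (mem_set Hy) (mem_set Hz)).
have Hmul y z : H y -> H z -> H (y * z).
  move=> Hy Hz; rewrite -[z]invgK -[z^-1]mul1g.
  exact/Hdiv/Hdiv.
have /gen_prodgP[m [c cA ->]] : x \in <<A>>%g by [].
elim/big_ind: _ => [|y z Hy Hz|i _]; first by rewrite psi1.
  by rewrite psiM; exact: Hmul.
by apply: AH; exists (c i) => //; exact: cA.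
Qed.

Lemma isomorphic_image_inj (A : {set gT}) : injective psi ->
  subgroups_isomorphic (psi @` [set` A]) [set` A].
Proof.
move=> psi_inj; pose phi g := xget 1 [set x | psi x = g].
have psiK x : phi (psi x) = x.
  by apply: psi_inj; apply: (@xgetPex _ 1 [set y | psi y = psi x]); exists x.
exists phi; split=> [_ _ /set_mem[x _ <-] /set_mem[y _ <-]|].
  by rewrite -psiM !psiK.
split.
- by move=> _ [x xA <-]; rewrite /= psiK.
- by move=> _ _ /set_mem[x _ <-] /set_mem[y _ <-]; rewrite !psiK => ->.
- by move=> x xA; exists (psi x) => //; exists x.
Qed.

End GeneratedImage.

(** * Prefixes and tails of infinite words *)

Lemma continuous_to_infinite_word n (X : topologicalType)
    (g : X -> infinite_word n) :
  (forall i x, nbhs x [set y | g y i = g x i]) -> continuous g.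
Proof.
move=> gi x; have FF : Filter (g @ x).
  by apply: fmap_filter; exact: nbhs_filter.
apply/cvg_sup => i; apply/cvg_image.
  by rewrite eqEsubset; split => // y _; exists (fun=> y).
move=> U /= /principal_filterP Ui.
exists [set e : infinite_word n | U (e i)].
  by apply: filterS (gi i x) => e /= ->.
by rewrite eqEsubset; split => [y [e ? <-]//|y Uy]; exists (fun=> y).
Qed.

(** For a continuous map into infinite words, each letter of the value is
    locally constant, the alphabet being discrete. *)
Lemma nbhs_letter n (X : topologicalType) (g : X -> infinite_word n) i x :
  continuous g -> nbhs x [set y | g y i = g x i].
Proof.
move=> gc; have gx : nbhs (g x) [set e : infinite_word n | e i = g x i].
  apply: (@infinite_word_letter_continuous n i (g x) [set g x i]).
  exact: (@discrete_set1 (discrete_topology 'I_n)).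
exact: gc gx.
Qed.

Section Splice.
Variables (n k : nat).
Implicit Types (w : k.-tuple 'I_n) (d : infinite_word n).

(** The first [k] letters of an infinite word, and the word that remains when
    they are removed. *)
Definition prefix_tuple d : k.-tuple 'I_n :=
  Tuple (introT eqP (size_mkseq (d : nat -> 'I_n) k)).

Definition tail d : infinite_word n := fun i => d (k + i)%N.

(** The concatenation of the word [w] and the infinite word [d]: at positions
    beyond [w], [nth] returns its default value, a letter of [d]. *)
Definition splice w d : infinite_word n := fun i => nth (d (i - k)%N) w i.

Lemma spliceP d : splice (prefix_tuple d) (tail d) = d.
Proof.
apply/funext => i; rewrite /splice /=; have [ik|ki] := ltnP i k.
  by rewrite nth_mkseq.
by rewrite nth_default ?size_mkseq // /tail subnKC.
Qed.

Lemma prefix_splice w d : prefix_tuple (splice w d) = w.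
Proof.
apply: eq_from_tnth => i; rewrite (tnth_nth (d 0%N)) /= nth_mkseq // /splice.
by rewrite (tnth_nth (d 0%N)); apply: set_nth_default; rewrite size_tuple.
Qed.

Lemma tail_splice w d : tail (splice w d) = d.
Proof.
apply/funext => i.
by rewrite /tail /splice nth_default ?size_tuple ?leq_addr // addKn.
Qed.

Lemma tail_continuous : continuous tail.
Proof.
apply: continuous_to_infinite_word => i d.
by apply: (@nbhs_letter n _ id) => ?; exact: cvg_id.
Qed.

Lemma splice_continuous (u : k.-tuple 'I_n -> k.-tuple 'I_n)
    (g : k.-tuple 'I_n -> infinite_word n -> infinite_word n) :
  (forall w, continuous (g w)) ->
  continuous
    (fun d => splice (u (prefix_tuple d)) (g (prefix_tuple d) (tail d))).
Proof.
move=> gc; apply: continuous_to_infinite_word => i d.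
have gd : continuous (g (prefix_tuple d) \o tail).
  by move=> e; apply: continuous_comp; [exact: tail_continuous | exact: gc].
apply: filterS2 (nbhs_prefix d k) (nbhs_letter (i - k)%N d gd) => /= e ed gi.
have -> : prefix_tuple e = prefix_tuple d by exact: val_inj.
by rewrite /splice gi.
Qed.

End Splice.

(** * The wreath product decomposition at a given level *)

Section Wreath.
Variables (n k : nat).
Implicit Types (u v : {perm k.-tuple 'I_n}).
Implicit Types (g h : k.-tuple 'I_n -> homeo (infinite_word n)).

Definition wreath_fun u g (d : infinite_word n) : infinite_word n :=
  splice (u (prefix_tuple k d)) (g (prefix_tuple k d) (tail k d)).

Lemma wreath_fun_mul u v g h :
  wreath_fun v h \o wreath_fun u g =
  wreath_fun (u * v) (fun w => g w * h (u w)).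
Proof.
by apply/funext => d; rewrite /wreath_fun /= prefix_splice tail_splice permM.
Qed.

Lemma wreath_fun1 u g d :
  u = 1 -> (forall w, g w = 1) -> wreath_fun u g d = d.
Proof. by move=> -> g1; rewrite /wreath_fun perm1 g1 /= spliceP. Qed.

Lemma wreath_funK u g :
  cancel (wreath_fun u g) (wreath_fun u^-1 (fun w => (g (u^-1 w))^-1)).
Proof.
move=> d; rewrite -[LHS]/((_ \o wreath_fun u g) d) wreath_fun_mul.
by apply: wreath_fun1 => [|w]; rewrite ?permK mulgV.
Qed.

Lemma wreath_funVK u g :
  cancel (wreath_fun u^-1 (fun w => (g (u^-1 w))^-1)) (wreath_fun u g).
Proof.
move=> d; rewrite -[LHS]/((wreath_fun u g \o _) d) wreath_fun_mul.
by apply: wreath_fun1 => [|w]; rewrite mulVg.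
Qed.

Lemma wreath_continuous u g : continuous (wreath_fun u g).
Proof.
by apply: (@splice_continuous n k u g) => w; exact: homeo_continuous.
Qed.

(** The homeomorphism that applies [u] to the prefix [w] of length [k] and
    [g w] to the tail. *)
Definition wreath u g : homeo (infinite_word n) :=
  Homeo (wreath_funK u g) (wreath_funVK u g)
    (@wreath_continuous u g) (@wreath_continuous _ _).

Lemma wreath_mul u v g h :
  wreath u g * wreath v h = wreath (u * v) (fun w => g w * h (u w)).
Proof.
apply: homeoP => d.
by rewrite -[LHS]/((wreath_fun v h \o wreath_fun u g) d) wreath_fun_mul.
Qed.

Lemma wreath_perm_inj u v g h : (0 < n)%N -> wreath u g = wreath v h -> u = v.
Proof.
move=> n0 euv; apply/permP => w.
(* An arbitrary infinite word, to be appended to [w]. *)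
pose d : infinite_word n := fun=> Ordinal n0.
have /(congr1 (prefix_tuple k)) :
  wreath_fun u g (splice w d) = wreath_fun v h (splice w d).
  by rewrite -[LHS]/(wreath u g _) euv.
by rewrite /wreath_fun !prefix_splice.
Qed.

End Wreath.

Lemma trans_word_cat n (T : transducer n) (v w : seq 'I_n) (q : state T) :
  trans_word (v ++ w) q = trans_word w (trans_word v q).
Proof. by elim: v q => //= x v IH q. Qed.

(** The wreath recursion: on the word [w d], with [w] of length [k], a state
    outputs its image of [w] and hands [d] over to the state reached. *)
Lemma state_homeo_wreath n (T : invertible_transducer n) k (q : state T) :
  state_homeo q =
  wreath (level_perm k q) (fun w => state_homeo (trans_word w q)).
Proof.
apply: homeoP => d; apply/funext => i.
rewrite /= /wreath_fun /splice permE /=.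
have [ik|ki] := ltnP i k.
  rewrite -mkseq_out_infinite (set_nth_default (out_infinite q d i)).
    by rewrite nth_mkseq.
  by rewrite size_mkseq.
rewrite nth_default ?(eqP (size_out_word _ _)) ?size_mkseq //.
rewrite /out_infinite -trans_word_cat {1}/tail subnKC //; congr (out _ _).
congr (trans_word _ q); rewrite -{1}(subnKC ki) /mkseq iotaD map_cat add0n.
by congr cat; rewrite -[X in iota X]addn0 iotaDl -map_comp.
Qed.

(** * Synchronization *)

(** The inverse transducer reading [w] follows the path of [T] along the
    output. *)
Lemma trans_word_out_inverse n (T : invertible_transducer n) w (q : state T) :
  trans_word (@out_word n (inverse T) w q) q = @trans_word n (inverse T) w q.
Proof. by elim: w q => //= x w IH q; rewrite out_invVK; exact: IH. Qed.

Lemma trans_word_product n (T S : invertible_transducer n) w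
    (t : state T) (s : state S) :
  @trans_word n (product T S) w (t, s) =
  (trans_word w t, trans_word (out_word w t) s).
Proof. by elim: w t s => //= x w IH t s; exact: IH. Qed.

Lemma out_word_product n (T S : invertible_transducer n) w
    (t : state T) (s : state S) :
  @out_word n (product T S) w (t, s) = out_word (out_word w t) s.
Proof. by elim: w t s => //= x w IH t s; congr cons; exact: IH. Qed.

Section Synchronizing.
Variables (n : nat) (T : invertible_transducer n) (k : nat).
Variable f : k.-tuple 'I_n -> state T.
Hypothesis fP : forall (a : k.-tuple 'I_n) (q : state T), trans_word a q = f a.

Let TS := product T (inverse T).

Lemma trans_word_sync (w : k.-tuple 'I_n) (p : state TS) :
  trans_word w p = (f w, f (level_perm k p w)).
Proof.
case: p => t s; rewrite trans_word_product fP; congr pair.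
rewrite -trans_word_out_inverse -out_word_product permE.
exact: (fP (out_tuple (T := TS) (t, s) w)).
Qed.

(** The homeomorphism [w d |-> (u w) (T_(f w) T_(f (u w))^-1 d)], that is, the
    permutation [u] of the prefixes conjugated by [w d |-> w (T_(f w) d)]. *)
Definition sync_lift (u : {perm k.-tuple 'I_n}) : homeo (infinite_word n) :=
  wreath u (fun w => state_homeo (f w) * (state_homeo (f (u w)))^-1).

Lemma sync_liftM : {morph sync_lift : u v / u * v}.
Proof.
move=> u v; rewrite /sync_lift wreath_mul; congr wreath.
by apply/funext => w; rewrite permM mulgA mulgKV.
Qed.

Lemma sync_lift_level_perm (p : state TS) :
  sync_lift (level_perm k p) = state_homeo p.
Proof.
rewrite [RHS](state_homeo_wreath k); congr wreath; apply/funext => w.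
by rewrite trans_word_sync state_homeo_product state_homeo_inverse.
Qed.

Lemma automaton_group_sync :
  automaton_group TS = sync_lift @` [set` level_group TS k].
Proof.
rewrite /level_group -(generated_subgroup_image sync_liftM).
congr generated_subgroup; apply/seteqP.
split=> [_ [p _ <-]|_ [_ /imsetP[p _ ->] <-]].
  by exists (level_perm k p); [exact: imset_f | exact: sync_lift_level_perm].
by exists p => //; rewrite sync_lift_level_perm.
Qed.

End Synchronizing.

Theorem mainTheorem3 (n : nat) (T : invertible_transducer n) (k : nat) :
  (2 <= n)%N ->
  minimal T ->
  one_way_synchronizing T ->
  (0 < k)%N ->
  minimal_synchronizing_length T k ->
  let TS := product T (inverse T) in
  subgroups_isomorphic (automaton_group TS)
    [set` level_group TS k]%classic
  /\ finite_set (automaton_group TS).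
Proof.
move=> n2 _ _ _ [[f fP] _] TS; rewrite (automaton_group_sync fP); split.
  apply: (isomorphic_image_inj (sync_liftM f)) => u v.
  by apply: wreath_perm_inj; exact: ltnW.
by apply: finite_image; exact: finite_finpred.
Qed.
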